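(* Let $c_1,c_2>0$, let the two blocks be discretized by summation-by-parts operators as described in the context, and let $I_{v2u}\in\mathbb{R}^{m_y^{(u)}\times m_y^{(v)}}$, $I_{u2v}\in\mathbb{R}^{m_y^{(v)}\times m_y^{(u)}}$ be a norm-compatible pair of interpolation operators, i.e. $(I_{v2u}b)^\top H^{(u)}a=b^\top H^{(v)}(I_{u2v}a)$ for all $a\in\mathbb{R}^{m_y^{(u)}}$, $b\in\mathbb{R}^{m_y^{(v)}}$. Put $$L=\begin{bmatrix} e_E^{(u)} & -I_{v2u}\,e_W^{(v)}\end{bmatrix},\qquad P=I-\hat H^{-1}L^\top(L\hat H^{-1}L^\top)^{-1}L,$$ $$SAT=\begin{bmatrix}0&0\\ -(H_x^{(v)})^{-1}(e_W^{(v)})^\top c_1^2 I_{u2v}\,d_E^{(u)} & (H_x^{(v)})^{-1}(e_W^{(v)})^\top c_2^2\, d_W^{(v)}\end{bmatrix},\qquad \tilde D=D+SAT .$$ Then the system of ordinary differential equations $$w_{tt}=P\,\tilde D\,P\,w,\qquad w=\begin{bmatrix}u\\ v\end{bmatrix},$$ is a stable approximation of the two-block wave equation with a non-conforming interface, in the following sense: for every solution $w(t)$, $t\ge 0$, writing $\hat w=\begin{bmatrix}\hat u\\ \hat v\end{bmatrix}=Pw$, the quantity $$E=u_t^\top\bar H^{(u)}u_t+c_1^2\,\hat u^\top\big(H_y^{(u)}M_x^{(u)}+H_x^{(u)}M_y^{(u)}\big)\hat u+v_t^\top\bar H^{(v)}v_t+c_2^2\,\hat v^\top\big(H_y^{(v)}M_x^{(v)}+H_x^{(v)}M_y^{(v)}\big)\hat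 v$$ satisfies $E\ge 0$ and $\frac{d}{dt}E=0$.
   Context: **Continuous problem.** A rectangle is split by a vertical interface $\partial\Omega_I$ into a left block $\Omega_L$ and a right block $\Omega_R$. The problem is $u_{tt}=c_1^2\Delta u$ in $\Omega_L$, $v_{tt}=c_2^2\Delta v$ in $\Omega_R$, Neumann conditions on the outer boundaries (taken homogeneous for the stability analysis), and interface conditions $u=v$, $c_1^2u_x=c_2^2v_x$ on $\partial\Omega_I$. **One-dimensional operators.** For each block and each coordinate direction with $m\ge 2$ equidistant grid points there is a second-derivative summation-by-parts operator $$D_2=H^{-1}(-M+e_rd_r^\top-e_ld_l^\top)\in\mathbb{R}^{m\times m},$$ where $H$ is diagonal positive definite, $M$ is symmetric positive semi-definite, $e_l^\top,e_r^\top$ are the row vectors extracting the first and last entries, and $d_l^\top,d_r^\top$ are row vectors giving consistent approximations of the first derivative at the first and last grid points (in particular they give $0$ on constant grid vectors and $1$ on the vector of grid coordinates). $D_2$ approximates the second derivative. The operators may differ between directions and between blocks (sizes and grid spacings differ). **Two-dimensional operators.** In a block with $m_x\times m_y$ grid points, solution vectors lie in $\mathbb{R}^{m_xm_y}$ and are ordered column-major. In each Kronecker product below, the one-dimensional operator is that of the corresponding direction: - $D_{2x}=D_2\otimes I_{m_y}$, $D_{2y}=I_{m_x}\otimes D_2$ - $H_x=H\otimes I_{m_y}$, $H_y=I_{m_x}\otimes H$ - $M_x=M\otimes I_{m_y}$, $M_y=I_{m_x}\otimes M$ - $e_W=e_l^\top\otimes I_{m_y}$, $e_E=e_r^\top\otimes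 I_{m_y}$, $e_S=I_{m_x}\otimes e_l^\top$, $e_N=I_{m_x}\otimes e_r^\top$ - $d_W=d_l^\top\otimes I_{m_y}$, $d_E=d_r^\top\otimes I_{m_y}$, $d_S=I_{m_x}\otimes d_l^\top$, $d_N=I_{m_x}\otimes d_r^\top$ - $\bar H=H_xH_y$ Superscripts $(u)$ and $(v)$ denote operators of the left and right block, respectively. $H^{(u)}\in\mathbb{R}^{m_y^{(u)}\times m_y^{(u)}}$ and $H^{(v)}\in\mathbb{R}^{m_y^{(v)}\times m_y^{(v)}}$ denote the one-dimensional $y$-direction matrices $H$ of the two blocks (the inner products along the interface). The interface is the east side of the left block and the west side of the right block. The numbers $m_y^{(u)}$ and $m_y^{(v)}$ need not be equal (non-conforming grids). $I_{u2v}$ and $I_{v2u}$ interpolate interface grid functions from left to right and from right to left, respectively. **Discrete Laplacians.** The discrete Laplacians are $D_{2x}+D_{2y}$ plus penalty terms weakly imposing the homogeneous Neumann conditions on the outer (non-interface) sides only: $$D_L^{(u)}=D_{2x}+D_{2y}+H_x^{-1}e_W^\top d_W+H_y^{-1}e_S^\top d_S-H_y^{-1}e_N^\top d_N\quad\text{(all operators of block }(u)),$$ $$D_L^{(v)}=D_{2x}+D_{2y}-H_x^{-1}e_E^\top d_E+H_y^{-1}e_S^\top d_S-H_y^{-1}e_N^\top d_N\quad\text{(all operators of block }(v)).$$ **Global operators.** $$D=\begin{bmatrix}c_1^2D_L^{(u)}&0\\0&c_2^2D_L^{(v)}\end{bmatrix},\qquad \hat H=\begin{bmatrix}\bar H^{(u)}&0\\0&\bar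 H^{(v)}\end{bmatrix}.$$ The condition $Lw=0$ discretizes continuity of the solution across the interface, and the term $SAT$ weakly imposes continuity of $c^2$ times the first derivative. *)

(* Defs.v *)
From HB Require Import structures.
From mathcomp Require Import all_boot all_order all_algebra.
From mathcomp Require Import all_classical all_reals all_analysis.
From mathcomp.real_closed Require Export mxtens.
Import Order.TTheory GRing.Theory Num.Theory.
Import numFieldNormedType.Exports.
Set Implicit Arguments.
Unset Strict Implicit.
Unset Printing Implicit Defensive.
Local Open Scope classical_set_scope.
Local Open Scope ring_scope.

(* The two-sided derivative for t > 0 and the right derivative at t = 0. *)
Definition is_derive_nonneg (R : realType) (V : normedModType R)
    (f : R -> V) (t : R) (df : V) : Prop :=
  (fun s => (s - t)^-1 *: (f s - f t)) @ within [set s | 0 <= s] t^' --> df.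

Definition qform (R : realType) (n : nat) (A : 'M[R]_n) (x : 'cV[R]_n) : R :=
  (x^T *m A *m x) 0 0.

Definition posdefmx (R : realType) (n : nat) (A : 'M[R]_n) : Prop :=
  forall x : 'cV[R]_n, x != 0 -> 0 < qform A x.

Definition possemidefmx (R : realType) (n : nat) (A : 'M[R]_n) : Prop :=
  forall x : 'cV[R]_n, 0 <= qform A x.

(* The coordinates a + i (b - a) / (m - 1), both end points included. *)
Definition grid (R : realType) (m : nat) (a b : R) : 'cV[R]_m :=
  \col_(i < m) (a + (b - a) * i%:R / m.-1%:R).

Definition e_l (R : realType) (m : nat) : 'rV[R]_m :=
  \row_(i < m) (i == 0 :> nat)%:R.
Definition e_r (R : realType) (m : nat) : 'rV[R]_m :=
  \row_(i < m) (i == m.-1 :> nat)%:R.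

(* A second-derivative summation-by-parts operator on m equidistant points of
   [a, b]; see D2 below for the operator itself.  "Consistent" for the boundary
   derivatives d_l, d_r means exact on affine grid functions; that D2 is an
   accurate second derivative is an asymptotic requirement and not part of the
   structure. *)
Record sbp (R : realType) (m : nat) (a b : R) := Sbp {
  sbpH : 'M[R]_m;
  sbpM : 'M[R]_m;
  d_l : 'rV[R]_m;
  d_r : 'rV[R]_m;
  sbp_size : (1 < m)%N;
  sbp_interval : a < b;
  sbpH_diag : is_diag_mx sbpH;
  sbpH_posdef : posdefmx sbpH;
  sbpM_sym : sbpM^T = sbpM;
  sbpM_psd : possemidefmx sbpM;
  d_l_const : d_l *m (const_mx 1 : 'cV[R]_m) = 0;
  d_l_grid : d_l *m grid m a b = 1%:M;
  d_r_const : d_r *m (const_mx 1 : 'cV[R]_m) = 0;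
  d_r_grid : d_r *m grid m a b = 1%:M
}.

Definition D2 (R : realType) (m : nat) (a b : R) (S : sbp m a b) : 'M[R]_m :=
  invmx (sbpH S) *m
    (- sbpM S + (e_r R m)^T *m d_r S - (e_l R m)^T *m d_l S).

(* Operators of one block.  X and Y are the one-dimensional operators of the
   x- and y-directions; *t is the Kronecker product, for which the entry of
   grid point (i, j) has index i * my + j, i.e. the column-major ordering.
   The rows of e_W, e_E, d_W, d_E are indexed by 'I_(1 * my), which castmx
   identifies with 'I_my (similarly for the other two sides). *)
Section Block.
Variables (R : realType) (mx my : nat) (a b c d : R).
Variables (X : sbp mx a b) (Y : sbp my c d).

Definition D2x : 'M[R]_(mx * my) := D2 X *t (1%:M : 'M[R]_my).
Definition D2y : 'M[R]_(mx * my) := (1%:M : 'M[R]_mx) *t D2 Y.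
Definition Hx : 'M[R]_(mx * my) := sbpH X *t (1%:M : 'M[R]_my).
Definition Hy : 'M[R]_(mx * my) := (1%:M : 'M[R]_mx) *t sbpH Y.
Definition Mx : 'M[R]_(mx * my) := sbpM X *t (1%:M : 'M[R]_my).
Definition My : 'M[R]_(mx * my) := (1%:M : 'M[R]_mx) *t sbpM Y.
Definition Hbar : 'M[R]_(mx * my) := Hx *m Hy.

Definition rowx (r : 'rV[R]_mx) : 'M[R]_(my, mx * my) :=
  castmx (mul1n my, erefl) (r *t (1%:M : 'M[R]_my)).
Definition rowy (r : 'rV[R]_my) : 'M[R]_(mx, mx * my) :=
  castmx (muln1 mx, erefl) ((1%:M : 'M[R]_mx) *t r).

Definition e_W := rowx (e_l R mx).
Definition e_E := rowx (e_r R mx).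
Definition e_S := rowy (e_l R my).
Definition e_N := rowy (e_r R my).
Definition d_W := rowx (d_l X).
Definition d_E := rowx (d_r X).
Definition d_S := rowy (d_l Y).
Definition d_N := rowy (d_r Y).

(* Discrete Laplacians of the left and of the right block: the penalties act on
   the three outer sides only. *)
Definition DLu : 'M[R]_(mx * my) :=
  D2x + D2y + invmx Hx *m e_W^T *m d_W
    + invmx Hy *m e_S^T *m d_S - invmx Hy *m e_N^T *m d_N.
Definition DLv : 'M[R]_(mx * my) :=
  D2x + D2y - invmx Hx *m e_E^T *m d_E
    + invmx Hy *m e_S^T *m d_S - invmx Hy *m e_N^T *m d_N.

Definition energy_mx : 'M[R]_(mx * my) := Hy *m Mx + Hx *m My.

End Block.

Arguments e_W R mx my : clear implicits.
Arguments e_E R mx my : clear implicits.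
Arguments e_S R mx my : clear implicits.
Arguments e_N R mx my : clear implicits.

(* The left block is [xW, xI] x [yS, yN] with operators Xu, Yu, the right block
   is [xI, xE] x [yS, yN] with operators Xv, Yv; the interface is x = xI. *)
Section TwoBlocks.
Variables (R : realType) (mxu myu mxv myv : nat) (xW xI xE yS yN : R).
Variables (Xu : sbp mxu xW xI) (Yu : sbp myu yS yN).
Variables (Xv : sbp mxv xI xE) (Yv : sbp myv yS yN).
Variables (c1 c2 : R).
Variables (Iv2u : 'M[R]_(myu, myv)) (Iu2v : 'M[R]_(myv, myu)).

Let N := (mxu * myu + mxv * myv)%N.

Definition norm_compatible : Prop :=
  forall (a : 'cV[R]_myu) (b : 'cV[R]_myv),
    (Iv2u *m b)^T *m sbpH Yu *m a = b^T *m sbpH Yv *m (Iu2v *m a).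

Definition Dglob : 'M[R]_N :=
  block_mx (c1 ^+ 2 *: DLu Xu Yu) 0 0 (c2 ^+ 2 *: DLv Xv Yv).

Definition Hhat : 'M[R]_N := block_mx (Hbar Xu Yu) 0 0 (Hbar Xv Yv).

Definition Lop : 'M[R]_(myu, N) :=
  row_mx (e_E R mxu myu) (- (Iv2u *m e_W R mxv myv)).

(* Lop has full row rank because e_E has, so the inverse of the Schur
   complement Lop * Hhat^-1 * Lop^T is a genuine one. *)
Definition Pproj : 'M[R]_N :=
  1%:M - invmx Hhat *m Lop^T *m invmx (Lop *m invmx Hhat *m Lop^T) *m Lop.

Definition SAT : 'M[R]_N :=
  block_mx 0 0
    (- (invmx (Hx myv Xv) *m (e_W R mxv myv)^T *m
          (c1 ^+ 2 *: Iu2v) *m d_E myu Xu))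
    (invmx (Hx myv Xv) *m (e_W R mxv myv)^T *m (c2 ^+ 2 *: d_W myv Xv)).

Definition Dtilde : 'M[R]_N := Dglob + SAT.

(* w solves w_tt = P Dtilde P w on t >= 0, and wt is its time derivative. *)
Definition is_solution (w wt : R -> 'cV[R]_N) : Prop :=
  forall t : R, 0 <= t ->
    is_derive_nonneg w t (wt t) /\
    is_derive_nonneg wt t (Pproj *m Dtilde *m Pproj *m w t).

Definition energy (w wt : 'cV[R]_N) : R :=
  let what := Pproj *m w in
  qform (Hbar Xu Yu) (usubmx wt)
  + c1 ^+ 2 * qform (energy_mx Xu Yu) (usubmx what)
  + qform (Hbar Xv Yv) (dsubmx wt)
  + c2 ^+ 2 * qform (energy_mx Xv Yv) (dsubmx what).

End TwoBlocks.

(* Main.v *)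
(* Let A be the block diagonal matrix of the c^2 (H_y M_x + H_x M_y).  Summation
   by parts cancels every outer boundary term of Hhat D against the Neumann
   penalties; norm compatibility of the interpolation pair makes the SAT term
   turn the remaining interface terms into a multiple of L^T, so that
   Hhat Dtilde = c1^2 L^T H^(u) [d_E 0] - A.  The projection is self-adjoint for
   Hhat and satisfies L P = 0, hence Hhat P Dtilde P = - P^T A P, and
   E = w_t^T Hhat w_t + w^T P^T A P w is the conserved energy of
   Hhat w_tt = - P^T A P w. *)
Require Import Defs.
From mathcomp Require Import all_boot all_order all_algebra.
From mathcomp Require Import all_classical all_reals all_analysis.
From mathcomp Require Import ring.
Import Order.TTheory GRing.Theory Num.Theory.
Import numFieldNormedType.Exports.
Set Implicit Arguments.
Unset Strict Implicit.
Unset Printing Implicit Defensive.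
Local Open Scope ring_scope.

(** * Quadratic forms and positive definite matrices *)

Section QuadraticForms.
Variable R : realType.

Lemma qformE n (A : 'M[R]_n) x :
  qform A x = \sum_i \sum_j x i 0 * A i j * x j 0.
Proof.
rewrite /qform mxE exchange_big; apply: eq_bigr => j _ /=.
by rewrite mxE mulr_suml; apply: eq_bigr => i _; rewrite mxE.
Qed.

Lemma qform_mul m n (A : 'M[R]_m) (B : 'M[R]_(m, n)) x :
  qform A (B *m x) = qform (B^T *m A *m B) x.
Proof. by rewrite /qform trmx_mul !mulmxA. Qed.

Lemma qformD n (A B : 'M[R]_n) x : qform (A + B) x = qform A x + qform B x.
Proof. by rewrite /qform mulmxDr mulmxDl mxE. Qed.

Lemma qformZ n (a : R) (A : 'M[R]_n) x : qform (a *: A) x = a * qform A x.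
Proof. by rewrite /qform -scalemxAr -scalemxAl mxE. Qed.

Lemma qform_block_diag m n (A : 'M[R]_m) (B : 'M[R]_n) x :
  qform (block_mx A 0 0 B) x = qform A (usubmx x) + qform B (dsubmx x).
Proof.
rewrite /qform -{1 2}[x]vsubmxK tr_col_mx mul_row_block !mulmx0 addr0 add0r.
by rewrite mul_row_col mxE.
Qed.

Lemma posdef_psd n (A : 'M[R]_n) : posdefmx A -> possemidefmx A.
Proof.
move=> pA x; have [->|/pA/ltW//] := eqVneq x 0.
by rewrite /qform mulmx0 mxE.
Qed.

Lemma psdD n (A B : 'M[R]_n) :
  possemidefmx A -> possemidefmx B -> possemidefmx (A + B).
Proof. by move=> pA pB x; rewrite qformD addr_ge0. Qed.

Lemma posdef_block_diag m n (A : 'M[R]_m) (B : 'M[R]_n) :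
  posdefmx A -> posdefmx B -> posdefmx (block_mx A 0 0 B).
Proof.
move=> pA pB x x0; rewrite qform_block_diag.
have [u0|/pA Au] := eqVneq (usubmx x) 0; last first.
  by rewrite ltr_pwDl ?posdef_psd.
have [d0|/pB Bd] := eqVneq (dsubmx x) 0; last by rewrite ltr_wpDl ?posdef_psd.
by case/eqP: x0; rewrite -[x]vsubmxK u0 d0 col_mx0.
Qed.

Lemma posdef_unitmx n (A : 'M[R]_n) : posdefmx A -> A \in unitmx.
Proof.
move=> pA; rewrite unitmxE unitfE; apply/det0P => -[v v0 vA].
have /pA : v^T != 0 by rewrite -(inj_eq (@trmx_inj _ _ _)) trmxK trmx0.
by rewrite /qform trmxK vA mul0mx mxE ltxx.
Qed.

Lemma posdef_congr m n (A : 'M[R]_m) (B : 'M[R]_(m, n)) :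
  (forall x : 'cV_n, B *m x = 0 -> x = 0) ->
  posdefmx A -> posdefmx (B^T *m A *m B).
Proof.
move=> injB pA x x0; rewrite -qform_mul; apply: pA.
by apply: contra_neq x0 => /injB.
Qed.

(** The inverse is congruent to [A] through itself: for symmetric [A], A^-1 = (A^-1)^T A A^-1. *)
Lemma posdef_inv n (A : 'M[R]_n) : A^T = A -> posdefmx A -> posdefmx (invmx A).
Proof.
move=> sA pA; have uA := posdef_unitmx pA.
have -> : invmx A = (invmx A)^T *m A *m invmx A.
  by rewrite trmx_inv sA mulVmx // mul1mx.
apply: posdef_congr => // x iAx0.
by rewrite -[x](mulKVmx uA) iAx0 mulmx0.
Qed.

Lemma posdef_diag_gt0 n (A : 'M[R]_n) k : posdefmx A -> 0 < A k k.
Proof.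
move=> pA; have /pA : delta_mx k 0 != 0 :> 'cV[R]_n.
  by apply/eqP => /matrixP/(_ k 0)/eqP; rewrite !mxE !eqxx oner_eq0.
by rewrite /qform trmx_delta -mulmxA -colE -rowE !mxE.
Qed.

Lemma form_sym n (A : 'M[R]_n) (u v : 'cV[R]_n) : A^T = A ->
  (u^T *m A *m v) 0 0 = (v^T *m A *m u) 0 0.
Proof.
move=> sA; transitivity ((u^T *m A *m v)^T 0 0); first by rewrite [RHS]mxE.
by rewrite !trmx_mul sA trmxK mulmxA.
Qed.

End QuadraticForms.

(** * Kronecker products and their definiteness *)

Section Kronecker.
Variable R : realType.

Lemma tensmxDl m n p q (A B : 'M[R]_(m, n)) (C : 'M[R]_(p, q)) :
  (A + B) *t C = A *t C + B *t C.
Proof. by apply/matrixP => i j; rewrite !mxE mulrDl. Qed.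

Lemma tensmxNl m n p q (A : 'M[R]_(m, n)) (C : 'M[R]_(p, q)) :
  (- A) *t C = - (A *t C).
Proof. by apply/matrixP => i j; rewrite !mxE mulNr. Qed.

Lemma tensmxDr m n p q (A : 'M[R]_(m, n)) (B C : 'M[R]_(p, q)) :
  A *t (B + C) = A *t B + A *t C.
Proof. by apply/matrixP => i j; rewrite !mxE mulrDr. Qed.

Lemma tensmxNr m n p q (A : 'M[R]_(m, n)) (C : 'M[R]_(p, q)) :
  A *t (- C) = - (A *t C).
Proof. by apply/matrixP => i j; rewrite !mxE mulrN. Qed.

Lemma tens11 m n : (1%:M : 'M[R]_m) *t (1%:M : 'M[R]_n) = 1%:M.
Proof.
apply/matrixP => i j; case: (mxtens_indexP i) => i1 i2.
case: (mxtens_indexP j) => j1 j2; rewrite tensmxE !mxE.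
rewrite (inj_eq (can_inj (@mxtens_indexK _ _))) xpair_eqE /=.
by case: eqP; case: eqP; rewrite ?mulr0 ?mul0r ?mulr1.
Qed.

Lemma sum_mxtens m n (F : 'I_(m * n) -> R) :
  \sum_i F i = \sum_i \sum_j F (mxtens_index (i, j)).
Proof.
rewrite pair_bigA /= (reindex (@mxtens_index m n)).
  by apply: eq_bigr => -[].
by exists (@mxtens_unindex m n) => i _;
  rewrite (mxtens_indexK, mxtens_unindexK).
Qed.

(** A diagonal [B] couples no two grid lines, so the form splits into one copy of [A] per line,
    weighted by a diagonal entry. Definiteness thus reduces to one dimension. *)
Lemma qform_tens_diagr m n (A : 'M[R]_m) (B : 'M[R]_n) x : is_diag_mx B ->
  qform (A *t B) x =
  \sum_k B k k * qform A (\col_i x (mxtens_index (i, k)) 0).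
Proof.
move=> /is_diag_mxP dB; rewrite qformE sum_mxtens exchange_big /=.
apply: eq_bigr => k _; rewrite qformE mulr_sumr; apply: eq_bigr => i _.
rewrite sum_mxtens mulr_sumr; apply: eq_bigr => j _.
rewrite (bigD1 k) //= big1 ?addr0 => [|l lk].
  by rewrite tensmxE !mxE; ring.
by rewrite tensmxE dB 1?eq_sym // !(mulr0, mul0r).
Qed.

Lemma qform_tens_diagl m n (A : 'M[R]_m) (B : 'M[R]_n) x : is_diag_mx A ->
  qform (A *t B) x =
  \sum_k A k k * qform B (\col_i x (mxtens_index (k, i)) 0).
Proof.
move=> /is_diag_mxP dA; rewrite qformE sum_mxtens /=.
apply: eq_bigr => k _; rewrite qformE mulr_sumr; apply: eq_bigr => i _.
rewrite sum_mxtens exchange_big mulr_sumr; apply: eq_bigr => j _ /=.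
rewrite (bigD1 k) //= big1 ?addr0 => [|l lk].
  by rewrite tensmxE !mxE; ring.
by rewrite tensmxE dA 1?eq_sym // !(mulr0, mul0r).
Qed.

Lemma psd_tens_diagr m n (A : 'M[R]_m) (B : 'M[R]_n) :
  is_diag_mx B -> posdefmx B -> possemidefmx A -> possemidefmx (A *t B).
Proof.
move=> dB pB pA x; rewrite qform_tens_diagr //; apply: sumr_ge0 => k _.
by rewrite mulr_ge0 // ltW // posdef_diag_gt0.
Qed.

Lemma psd_tens_diagl m n (A : 'M[R]_m) (B : 'M[R]_n) :
  is_diag_mx A -> posdefmx A -> possemidefmx B -> possemidefmx (A *t B).
Proof.
move=> dA pA pB x; rewrite qform_tens_diagl //; apply: sumr_ge0 => k _.
by rewrite mulr_ge0 // ltW // posdef_diag_gt0.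
Qed.

(** If the weighted sum over grid lines vanishes, each nonnegative summand does; the weights are
    positive, so every slice of [x] is zero, and hence [x] is. *)
Lemma posdef_tens_diagr m n (A : 'M[R]_m) (B : 'M[R]_n) :
  is_diag_mx B -> posdefmx B -> posdefmx A -> posdefmx (A *t B).
Proof.
move=> dB pB pA x x0; rewrite lt_neqAle psd_tens_diagr ?andbT //; last first.
  exact: posdef_psd.
rewrite eq_sym; apply: contra_neq x0; rewrite qform_tens_diagr // => /eqP.
rewrite psumr_eq0 => [/allP s0|k _]; last first.
  by rewrite mulr_ge0 ?posdef_psd // ltW // posdef_diag_gt0.
apply/colP => ik; case: (mxtens_indexP ik) => i k; rewrite mxE.
have := s0 k (mem_index_enum k); rewrite mulf_eq0 gt_eqF ?posdef_diag_gt0 //=.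
set y := (\col_ _ _); have [y0 _|/pA/gt_eqF->//] := eqVneq y 0.
by have /colP/(_ i) := y0; rewrite !mxE.
Qed.

End Kronecker.

(** * Restriction of grid functions to the sides of a block *)

Section Sides.
Variables (R : realType) (m n : nat).

(** Eliminates the cast once and for all: an index below [1 * n] is its own remainder modulo [n].
    Later proofs only see grid points (i, j). *)
Lemma rowxE (r : 'rV[R]_m) i j :
  rowx n r i j = r 0 (mxtens_unindex j).1 * (i == (mxtens_unindex j).2)%:R.
Proof.
rewrite castmxE !mxE ord1 cast_ord_id; congr (_ * (_ == _)%:R).
by apply: val_inj; rewrite /= modn_small.
Qed.

Lemma rowyE (r : 'rV[R]_n) i j :
  rowy m r i j = (i == (mxtens_unindex j).1)%:R * r 0 (mxtens_unindex j).2.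
Proof.
rewrite castmxE !mxE cast_ord_id ord1; congr ((_ == _)%:R * _).
by apply: val_inj; rewrite /= divn1.
Qed.

(** A matrix acting along a vertical side can act on every vertical grid line before the restriction
    to that side. *)
Lemma mul_rowx (B : 'M[R]_n) (r : 'rV_m) :
  B *m rowx n r = rowx n r *m (1%:M *t B).
Proof.
apply/matrixP => i j; case: (mxtens_indexP j) => j1 j2.
rewrite !mxE sum_mxtens exchange_big /=.
(* On the left only k = [j2] contributes; on the right only the grid point ([j1], [i]). *)
rewrite (bigD1 j2) //= [X in _ + X]big1 ?addr0 => [|k kj]; last first.
  by rewrite rowxE mxtens_indexK /= (negbTE kj) !mulr0.
rewrite (bigD1 i) //= [X in _ = _ + X]big1 ?addr0 => [|k ki]; last first.
  rewrite big1 // => l _.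
  by rewrite rowxE mxtens_indexK /= eq_sym (negbTE ki) mulr0 mul0r.
rewrite (bigD1 j1) //= big1 ?addr0 => [|k kj]; last first.
  by rewrite tensmxE !mxE (negbTE kj) mul0r mulr0.
by rewrite !rowxE tensmxE !mxtens_indexK /= !mxE !eqxx !mulr1 mul1r mulrC.
Qed.

(** Puts side terms into the Kronecker form in which summation by parts produces them, so that the
    two can cancel. *)
Lemma tr_rowx_mul (B : 'M[R]_n) (r s : 'rV_m) :
  (rowx n r)^T *m B *m rowx n s = (r^T *m s) *t B.
Proof.
apply/matrixP => i j; case: (mxtens_indexP i) => i1 i2.
case: (mxtens_indexP j) => j1 j2; rewrite tensmxE -mulmxA mxE.
rewrite (bigD1 i2) //= [X in _ + X]big1 ?addr0 => [|k ki]; last first.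
  by rewrite mxE rowxE mxtens_indexK /= (negbTE ki) mulr0 mul0r.
rewrite mxE rowxE mxtens_indexK /= eqxx mulr1.
rewrite mxE (bigD1 j2) //= [X in _ * (_ + X)]big1 ?addr0 => [|k kj]; last first.
  by rewrite rowxE mxtens_indexK /= (negbTE kj) !mulr0.
by rewrite rowxE mxtens_indexK /= eqxx mulr1 mxE big_ord1 !mxE mulrCA mulrC.
Qed.

Lemma tr_rowy_mul (r s : 'rV[R]_n) :
  (rowy m r)^T *m rowy m s = 1%:M *t (r^T *m s).
Proof.
apply/matrixP => i j; case: (mxtens_indexP i) => i1 i2.
case: (mxtens_indexP j) => j1 j2; rewrite tensmxE mxE.
rewrite (bigD1 i1) //= [X in _ + X]big1 ?addr0 => [|k ki]; last first.
  by rewrite mxE rowyE mxtens_indexK /= (negbTE ki) !mul0r.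
by rewrite mxE !rowyE !mxtens_indexK /= eqxx mul1r !mxE big_ord1 mxE; ring.
Qed.

(** The entries of [y] reappear at the grid points of the last column, of index [m.-1]. This is the
    full row rank of [e_E]. *)
Lemma e_E_tr_inj (y : 'cV[R]_n) :
  (0 < m)%N -> (e_E R m n)^T *m y = 0 -> y = 0.
Proof.
move=> m0 /colP ey; have lt_m : (m.-1 < m)%N by rewrite prednK.
apply/colP => i; have := ey (mxtens_index (Ordinal lt_m, i)).
rewrite !mxE (bigD1 i) //= big1 ?addr0 => [|k ki].
  by rewrite mxE rowxE mxtens_indexK /= !mxE /= !eqxx !mul1r.
by rewrite mxE rowxE mxtens_indexK /= (negbTE ki) mulr0 mul0r.
Qed.

End Sides.

(** * Summation by parts in a single block *)

Section BlockIdentities.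
Variables (R : realType) (mx my : nat) (a b c d : R).
Variables (X : sbp mx a b) (Y : sbp my c d).

Lemma diag_mx_sym n (A : 'M[R]_n) : is_diag_mx A -> A^T = A.
Proof.
move=> /is_diag_mxP dA; apply/matrixP => i j; rewrite mxE.
by have [->//|ij] := eqVneq i j; rewrite !dA // eq_sym.
Qed.

Lemma sbpH_unit m (p q : R) (S : sbp m p q) : sbpH S \in unitmx.
Proof. exact/posdef_unitmx/sbpH_posdef. Qed.

Lemma sbpH_sym m (p q : R) (S : sbp m p q) : (sbpH S)^T = sbpH S.
Proof. exact/diag_mx_sym/sbpH_diag. Qed.

Lemma HbarE : Hbar X Y = sbpH X *t sbpH Y.
Proof. by rewrite /Hbar /Hx /Hy tensmx_mul mulmx1 mul1mx. Qed.

Lemma Hbar_sym : (Hbar X Y)^T = Hbar X Y.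
Proof. by rewrite HbarE trmx_tens !sbpH_sym. Qed.

Lemma Hbar_posdef : posdefmx (Hbar X Y).
Proof.
rewrite HbarE; apply: posdef_tens_diagr; try exact: sbpH_posdef.
exact: sbpH_diag.
Qed.

Lemma energy_mxE : energy_mx X Y = sbpM X *t sbpH Y + sbpH X *t sbpM Y.
Proof. by rewrite /energy_mx /Hx /Hy /Mx /My !tensmx_mul !mulmx1 !mul1mx. Qed.

Lemma energy_mx_sym : (energy_mx X Y)^T = energy_mx X Y.
Proof. by rewrite energy_mxE linearD /= !trmx_tens !sbpH_sym !sbpM_sym. Qed.

Lemma energy_mx_psd : possemidefmx (energy_mx X Y).
Proof.
rewrite energy_mxE; apply: psdD; [apply: psd_tens_diagr|apply: psd_tens_diagl].
all: try exact: sbpH_diag; try exact: sbpH_posdef; exact: sbpM_psd.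
Qed.

Lemma invmx_Hx : invmx (Hx my X) = invmx (sbpH X) *t 1%:M.
Proof.
have HK : Hx my X *m (invmx (sbpH X) *t 1%:M) = 1%:M.
  by rewrite tensmx_mul mulmxV ?sbpH_unit // mulmx1 tens11.
(* A one-sided inverse of a square matrix already gives invertibility. *)
have [uH _] := mulmx1_unit HK.
by rewrite -[RHS](mulKmx uH) HK mulmx1.
Qed.

Lemma invmx_Hy : invmx (Hy mx Y) = 1%:M *t invmx (sbpH Y).
Proof.
have HK : Hy mx Y *m (1%:M *t invmx (sbpH Y)) = 1%:M.
  by rewrite tensmx_mul mulmxV ?sbpH_unit // mulmx1 tens11.
have [uH _] := mulmx1_unit HK.
by rewrite -[RHS](mulKmx uH) HK mulmx1.
Qed.

(** The product [Hbar] [Hx]^-1 acts only in y, so by [mul_rowx] it becomes the one-dimensional norm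
    on the side. This serves both the Neumann penalties and [SAT]. *)
Lemma Hbar_invHx_rowx (r : 'rV[R]_mx) :
  Hbar X Y *m invmx (Hx my X) *m (rowx my r)^T = (rowx my r)^T *m sbpH Y.
Proof.
rewrite HbarE invmx_Hx tensmx_mul mulmxV ?sbpH_unit // mulmx1.
rewrite -[sbpH Y in RHS]sbpH_sym -trmx_mul mul_rowx trmx_mul.
by rewrite trmx_tens trmx1 sbpH_sym.
Qed.

Lemma Hbar_penalty_x (r s : 'rV[R]_mx) :
  Hbar X Y *m (invmx (Hx my X) *m (rowx my r)^T *m rowx my s) =
  (r^T *m s) *t sbpH Y.
Proof. by rewrite !mulmxA Hbar_invHx_rowx tr_rowx_mul. Qed.

Lemma Hbar_penalty_y (r s : 'rV[R]_my) :
  Hbar X Y *m (invmx (Hy mx Y) *m (rowy mx r)^T *m rowy mx s) =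
  sbpH X *t (r^T *m s).
Proof.
rewrite -(mulmxA (invmx _)) tr_rowy_mul mulmxA HbarE invmx_Hy !tensmx_mul.
by rewrite mulmxV ?sbpH_unit // mulmx1 mulmx1 mul1mx.
Qed.

Lemma Hbar_D2 : Hbar X Y *m (D2x my X + D2y mx Y) =
  (- sbpM X + (e_r R mx)^T *m d_r X - (e_l R mx)^T *m d_l X) *t sbpH Y
  + sbpH X *t (- sbpM Y + (e_r R my)^T *m d_r Y - (e_l R my)^T *m d_l Y).
Proof.
rewrite mulmxDr HbarE /D2x /D2y !tensmx_mul !mulmx1 /D2.
by rewrite !mulKVmx ?sbpH_unit.
Qed.

(** Of the four boundary terms in [Hbar_D2], those on the west, south and north sides cancel the
    penalties; the east side is the interface and survives. *)
Lemma Hbar_DLu : Hbar X Y *m DLu X Y =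
  (e_E R mx my)^T *m sbpH Y *m d_E my X - energy_mx X Y.
Proof.
rewrite /DLu mulmxBr !(mulmxDr (Hbar X Y) (_ + _)) Hbar_D2.
rewrite Hbar_penalty_x !Hbar_penalty_y tr_rowx_mul energy_mxE.
rewrite !(tensmxDl, tensmxDr, tensmxNl, tensmxNr).
(* Once the six distinct Kronecker products are opaque, only a linear identity remains, checked
   entrywise. *)
by do 6!move: (_ *t _) => ?; apply/matrixP => i j; rewrite !mxE; ring.
Qed.

Lemma Hbar_DLv : Hbar X Y *m DLv X Y =
  - ((e_W R mx my)^T *m sbpH Y *m d_W my X) - energy_mx X Y.
Proof.
rewrite /DLv mulmxBr !(mulmxDr (Hbar X Y) (_ + _)) mulmxN Hbar_D2.
rewrite Hbar_penalty_x !Hbar_penalty_y tr_rowx_mul energy_mxE.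
rewrite !(tensmxDl, tensmxDr, tensmxNl, tensmxNr).
by do 6!move: (_ *t _) => ?; apply/matrixP => i j; rewrite !mxE; ring.
Qed.

End BlockIdentities.

(** * Differentiating quadratic forms on the half-line *)

Section Derivatives.
Variable R : realType.

Lemma cvg_bilinear_form (T : Type) (F : set_system T) (FF : Filter F) m n
    (A : 'M[R]_(m, n)) (f : T -> 'cV[R]_m) (g : T -> 'cV[R]_n)
    (a : 'cV[R]_m) (b : 'cV[R]_n) :
  (f @ F --> a)%classic -> (g @ F --> b)%classic ->
  ((fun x => ((f x)^T *m A *m g x) 0 0) @ F --> (a^T *m A *m b) 0 0)%classic.
Proof.
move=> fa gb.
have entry k (h : T -> 'cV[R]_k) (c : 'cV[R]_k) i : (h @ F --> c)%classic ->
    ((fun x => h x i 0) @ F --> c i 0)%classic.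
  by move=> hc; apply: (continuous_cvg _ (@coord_continuous R k 1 i 0 c) hc).
have formE u v : (u^T *m A *m v) 0 0 = \sum_j (\sum_i u i 0 * A i j) * v j 0.
  rewrite mxE; apply: eq_bigr => j _; rewrite mxE; congr (_ * _).
  by apply: eq_bigr => i _; rewrite mxE.
rewrite formE; under eq_fun do rewrite formE.
apply: cvg_big => [|j _]; first exact: add_continuous.
apply: cvgM; last exact: entry.
apply: cvg_big => [|i _]; first exact: add_continuous.
by apply: cvgMr_tmp; apply: entry.
Qed.

(** Differentiability implies continuity: away from [t], [f s] is [s - t] times the difference
    quotient, plus [f t]. *)
Lemma is_derive_nonneg_cvg (V : normedModType R) (f : R -> V) t df :
  is_derive_nonneg f t df ->
  (f @ within [set s | 0 <= s] t^' --> f t)%classic.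
Proof.
move=> fdf; set F := within _ _ in fdf *.
have FF : Filter F by exact: within_filter.
have s0 : ((fun s : R => s - t) @ F --> (0 : R))%classic.
  rewrite -(subrr t); apply: cvgB; last exact: cvg_cst.
  have tt : (t^' --> t)%classic by exact: cvg_within.
  exact: (cvg_within_filter [set s | 0 <= s]%classic tt).
have cv : ((fun s => (s - t) *: ((s - t)^-1 *: (f s - f t)) + f t) @ F
    --> f t)%classic.
  rewrite -[X in (_ --> X)%classic]add0r -(scale0r df).
  by apply: cvgD (cvgZ s0 fdf) (cvg_cst _).
apply: cvg_trans cv; apply: near_eq_cvg.
(* The filter is punctured at [t], so the division by [s - t] can be undone. *)
have neq_t : \forall s \near F, s != t.
  exact: (cvg_within _ (nbhs_dnbhs_neq t)).
near=> s.
have st : s - t != 0 by rewrite subr_eq0; near: s.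
by rewrite scalerA mulfV // scale1r subrK.
Unshelve. all: by end_near.
Qed.

Lemma is_derive_nonneg_qform n (A : 'M[R]_n) (f : R -> 'cV[R]_n) t df :
  A^T = A -> is_derive_nonneg f t df ->
  is_derive_nonneg (fun s => qform A (f s) : R^o) t
    (2 * (df^T *m A *m f t) 0 0).
Proof.
move=> sA fdf; have fc := is_derive_nonneg_cvg fdf.
have FF : Filter (within [set s : R | 0 <= s] t^')%classic.
  exact: within_filter.
(* By symmetry the factor 2 becomes the two product-rule terms. The difference quotient of the form
   splits likewise into q(s)^T A f(s) + f(t)^T A q(s); the first term needs the continuity [fc]. *)
rewrite mulr_natl mulr2n -{2}form_sym //; pose q s := (s - t)^-1 *: (f s - f t).
rewrite /is_derive_nonneg (_ : (fun s => _) =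
  (fun s => ((q s)^T *m A *m f s) 0 0) + (fun s => ((f t)^T *m A *m q s) 0 0)).
  apply: cvgD; first exact: cvg_bilinear_form.
  by apply: cvg_bilinear_form => //; exact: cvg_cst.
apply/funext => s; rewrite [RHS]/GRing.add /=.
have -> : (q s)^T = (s - t)^-1 *: ((f s)^T - (f t)^T).
  by rewrite linearZ linearB.
rewrite /q /qform -scalemxAr -!scalemxAl !(mulmxBl, mulmxBr).
have scE (x y : R) : x *: (y : R^o) = x * y by [].
by rewrite [LHS]scE !mxE; ring.
Qed.

Lemma is_derive_nonnegD (V : normedModType R) (f g : R -> V) t df dg :
  is_derive_nonneg f t df -> is_derive_nonneg g t dg ->
  is_derive_nonneg (fun s => f s + g s) t (df + dg).
Proof.
move=> fd gd; have FF : Filter (within [set s : R | 0 <= s] t^')%classic.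
  exact: within_filter.
rewrite /is_derive_nonneg (_ : (fun s => _) =
  (fun s => (s - t)^-1 *: (f s - f t)) + (fun s => (s - t)^-1 *: (g s - g t))).
  exact: cvgD.
by apply/funext => s; rewrite [RHS]/GRing.add /= -scalerDr opprD addrACA.
Qed.

End Derivatives.

(** * The projection and the coupled two-block operator *)

Section TwoBlocks.
Variables (R : realType) (mxu myu mxv myv : nat) (xW xI xE yS yN : R).
Variables (Xu : sbp mxu xW xI) (Yu : sbp myu yS yN).
Variables (Xv : sbp mxv xI xE) (Yv : sbp myv yS yN).
Variables (c1 c2 : R).
Variables (Iv2u : 'M[R]_(myu, myv)) (Iu2v : 'M[R]_(myv, myu)).

Local Notation H := (Hhat Xu Yu Xv Yv).
Local Notation L := (Lop mxu mxv Iv2u).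
Local Notation P := (Pproj Xu Yu Xv Yv Iv2u).

Definition stiffness : 'M[R]_(mxu * myu + mxv * myv) :=
  block_mx (c1 ^+ 2 *: energy_mx Xu Yu) 0 0 (c2 ^+ 2 *: energy_mx Xv Yv).

Lemma stiffness_sym : stiffness^T = stiffness.
Proof. by rewrite tr_block_mx !linear0 !linearZ /= !energy_mx_sym. Qed.

Lemma stiffness_psd : possemidefmx stiffness.
Proof.
move=> x; rewrite qform_block_diag !qformZ.
by apply: addr_ge0; rewrite mulr_ge0 ?sqr_ge0 //; apply: energy_mx_psd.
Qed.

Lemma Hhat_sym : H^T = H.
Proof. by rewrite tr_block_mx !linear0 !Hbar_sym. Qed.

Lemma Hhat_posdef : posdefmx H.
Proof. by apply: posdef_block_diag; apply: Hbar_posdef. Qed.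

Lemma Hhat_unit : H \in unitmx.
Proof. exact/posdef_unitmx/Hhat_posdef. Qed.

(** A congruence of the positive definite H^-1 by L^T, which is injective because its upper block is
    the transpose of [e_E]. *)
Lemma schur_unit : L *m invmx H *m L^T \in unitmx.
Proof.
apply: posdef_unitmx; rewrite -{1}[L]trmxK; apply: posdef_congr => [x|].
  rewrite tr_row_mx mul_col_mx => /eqP; rewrite col_mx_eq0 => /andP[/eqP ex _].
  by apply: e_E_tr_inj ex; apply: ltnW (sbp_size Xu).
exact: posdef_inv Hhat_sym Hhat_posdef.
Qed.

Lemma L_proj : L *m P = 0.
Proof.
by rewrite mulmxBr mulmx1 !mulmxA mulmxV ?schur_unit // mul1mx subrr.
Qed.

(** Multiplying by H cancels the leading H^-1 in P and leaves H - L^T S^-1 L with S = L H^-1 L^T,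
    which is symmetric. *)
Lemma Hhat_proj : H *m P = P^T *m H.
Proof.
have sHP : (H *m P)^T = H *m P.
  rewrite mulmxBr mulmx1 !mulmxA mulmxV ?Hhat_unit // mul1mx.
  rewrite linearB /= Hhat_sym !trmx_mul trmxK trmx_inv !trmx_mul trmxK.
  by rewrite trmx_inv Hhat_sym !mulmxA.
by rewrite -{1}sHP trmx_mul Hhat_sym.
Qed.

Variable Icompat : norm_compatible Yu Yv Iv2u Iu2v.

(** Testing the bilinear identity on basis vectors reads off its matrix entries. *)
Lemma norm_compatible_mx : Iv2u^T *m sbpH Yu = sbpH Yv *m Iu2v.
Proof.
apply/matrixP => i j.
have /matrixP/(_ 0 0) := Icompat (delta_mx j 0) (delta_mx i 0).
by rewrite trmx_mul trmx_delta -!mulmxA -!rowE !mulmxA -!colE !mxE.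
Qed.

Lemma Hhat_Dtilde : H *m Dtilde Xu Yu Xv Yv c1 c2 Iu2v =
  c1 ^+ 2 *: (L^T *m sbpH Yu *m row_mx (d_E myu Xu) 0) - stiffness.
Proof.
have Eu : Hbar Xv Yv *m - (invmx (Hx myv Xv) *m (e_W R mxv myv)^T *m
      (c1 ^+ 2 *: Iu2v) *m d_E myu Xu) =
    - (c1 ^+ 2 *: ((e_W R mxv myv)^T *m sbpH Yv *m Iu2v *m d_E myu Xu)).
  by rewrite mulmxN !mulmxA Hbar_invHx_rowx -scalemxAr -scalemxAl.
have Ev : Hbar Xv Yv *m (invmx (Hx myv Xv) *m (e_W R mxv myv)^T *m
      (c2 ^+ 2 *: d_W myv Xv)) =
    c2 ^+ 2 *: ((e_W R mxv myv)^T *m sbpH Yv *m d_W myv Xv).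
  by rewrite !mulmxA Hbar_invHx_rowx -scalemxAr.
rewrite /Dtilde /Dglob /SAT add_block_mx !addr0 add0r mulmx_block.
rewrite !mul0mx !mulmx0 !addr0 !add0r mulmxDr Eu Ev -!scalemxAr.
(* In the right block, the [c2] part of [SAT] cancels the surviving west term of [Hbar_DLv]. *)
rewrite Hbar_DLu Hbar_DLv -scalerDr addrAC addNr add0r.
rewrite /Lop tr_row_mx (linearN trmx) /= trmx_mul mul_col_mx mulNmx.
(* Compatibility matches the lower block of L^T H^(u) d_E with the [c1] part of [SAT]; the upper
   block is the east term of [Hbar_DLu]. *)
rewrite -(mulmxA _ Iv2u^T) norm_compatible_mx mul_col_row !mulmx0 mulNmx.
rewrite scale_block_mx opp_block_mx add_block_mx.
by rewrite scalerBr !scaler0 !subr0 sub0r !scalerN !mulmxA.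
Qed.

Lemma Hhat_proj_Dtilde_proj :
  H *m (P *m Dtilde Xu Yu Xv Yv c1 c2 Iu2v *m P) = - (P^T *m stiffness *m P).
Proof.
(* With P transparent, mulmxBr would distribute over its defining difference. *)
move: L_proj Hhat_proj; move: P => Q LQ HQ.
rewrite !mulmxA HQ -(mulmxA Q^T) Hhat_Dtilde mulmxBr -scalemxAr !mulmxA.
by rewrite -trmx_mul LQ trmx0 !mul0mx scaler0 sub0r mulNmx.
Qed.

Lemma energyE w wt : energy Xu Yu Xv Yv c1 c2 Iv2u w wt =
  qform H wt + qform (P^T *m stiffness *m P) w.
Proof.
rewrite -qform_mul /energy !qform_block_diag !qformZ /=.
by rewrite -!addrA; congr (_ + _); rewrite addrCA.
Qed.

End TwoBlocks.

(** * Nonnegativity and conservation of the energy *)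

Theorem lemma4p2 (R : realType) (mxu myu mxv myv : nat)
  (xW xI xE yS yN : R)
  (Xu : sbp mxu xW xI) (Yu : sbp myu yS yN)
  (Xv : sbp mxv xI xE) (Yv : sbp myv yS yN)
  (c1 c2 : R) (c1_gt0 : 0 < c1) (c2_gt0 : 0 < c2)
  (Iv2u : 'M[R]_(myu, myv)) (Iu2v : 'M[R]_(myv, myu))
  (Icompat : norm_compatible Yu Yv Iv2u Iu2v)
  (w wt : R -> 'cV[R]_(mxu * myu + mxv * myv))
  (w_sol : is_solution Xu Yu Xv Yv c1 c2 Iv2u Iu2v w wt) :
  let E : R -> R^o := fun t => energy Xu Yu Xv Yv c1 c2 Iv2u (w t) (wt t) in
  forall t : R, 0 <= t -> 0 <= E t /\ is_derive_nonneg E t 0.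
Proof.
move=> E t t0; rewrite {}/E; split.
  rewrite energyE addr_ge0 //; first exact/posdef_psd/Hhat_posdef.
  by rewrite -qform_mul; apply: stiffness_psd.
under eq_fun do rewrite energyE.
have [dw dwt] := w_sol t t0.
set K := (_ *m stiffness _ _ _ _ _ _ *m _).
have sK : K^T = K by rewrite !trmx_mul stiffness_sym trmxK mulmxA.
have sH := Hhat_sym Xu Yu Xv Yv.
have := is_derive_nonnegD (is_derive_nonneg_qform sH dwt)
  (is_derive_nonneg_qform sK dw).
(* Here [A] is the operator of the differential equation, while [K] is the projected stiffness
   matrix. *)
set A := Pproj _ _ _ _ _ *m _ *m _ in dwt *.
have HA : (A *m w t)^T *m Hhat Xu Yu Xv Yv = - ((w t)^T *m K).
  rewrite -[Hhat _ _ _ _ in LHS]sH -trmx_mul mulmxA Hhat_proj_Dtilde_proj //.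
  by rewrite mulNmx linearN /= trmx_mul sK.
(* The kinetic part contributes -2 w^T K w_t and the potential part 2 w_t^T K w; symmetry of [K]
   makes them cancel. *)
rewrite HA mulNmx mxE -mulrDr.
by rewrite (form_sym (w t) (wt t)) // addNr mulr0.
Qed.
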